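(* Let $a$ be a Barker sequence of even length $n\geq 4$. Then $a$ is weak symmetric, and $C_{k}=-a_{k}a_{n+1-k}$ for every odd $k$ with $1\leq k<n$.
   Context: For an integer $n>1$, a binary sequence of length $n$ is an element $a=(a_1,\dots,a_n)$ of $\{-1,1\}^n$. For $k=0,1,\dots,n-1$ its $k$th aperiodic autocorrelation is $C_k=C_k(a)=\sum_{j=1}^{n-k}a_ja_{j+k}$. A binary sequence $a$ of length $n$ is a Barker sequence if $C_k(a)\in\{-1,0,1\}$ for every $1\le k\le n-1$. A binary sequence $a$ of length $n$ is weak symmetric if $n$ is a multiple of $4$ and $a_ja_{j+1}=-a_{n+1-j}a_{n-j}$ for each odd integer $j$ with $1\le j<\frac n2$ (and thus for each odd $j$ with $1\le j<n$). *)

(* Defs.v *)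
From mathcomp Require Import all_boot all_order all_algebra.
Set Implicit Arguments.
Unset Strict Implicit.
Unset Printing Implicit Defensive.
Import GRing.Theory Num.Theory.
Local Open Scope ring_scope.

(* The term a_j with indices running from 1 to n; outside this range the value
   is the dummy 0. *)
Definition term (n : nat) (a : n.-tuple int) (j : nat) : int := (0 :: a)`_j.

Definition binary (n : nat) (a : n.-tuple int) : Prop :=
  forall j : nat, (1 <= j <= n)%N -> term a j = -1 \/ term a j = 1.

Definition autocorr (n : nat) (a : n.-tuple int) (k : nat) : int :=
  \sum_(1 <= j < (n - k).+1) term a j * term a (j + k).

Definition barker (n : nat) (a : n.-tuple int) : Prop :=
  binary a /\
  forall k : nat, (1 <= k <= n - 1)%N -> autocorr a k \in [:: -1; 0; 1].

(* The bound j < n / 2 is written 2 * j < n to avoid truncated division. *)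
Definition weak_symmetric (n : nat) (a : n.-tuple int) : Prop :=
  [/\ binary a, (4 %| n)%N &
      forall j : nat, odd j -> (1 <= j)%N -> (2 * j < n)%N ->
        term a j * term a (j + 1) = - (term a (n + 1 - j) * term a (n - j))].

(* Main.v *)
Require Import Defs.
From mathcomp Require Import all_boot all_order all_algebra.
From mathcomp Require Import zify ring.
Set Implicit Arguments.
Unset Strict Implicit.
Unset Printing Implicit Defensive.
Import GRing.Theory Num.Theory.
Local Open Scope ring_scope.

(** The sum of m signs determines their product: if t of them are -1, then the
    sum is m - 2t and the product is (-1)^t. For the signs a_j a_(j+k) with
    1 <= j <= n - k, the sum is C_k; let P_k be the product. For even n the
    Barker condition forces C_k = 0 when k is even and C_k = 1 or -1 when k is
    odd, so P_k = (-1)^((n-k)/2) for even k and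
    P_k = (-1)^((n-k-1)/2) C_k for odd k ([lag_prod_even], [lag_prod_odd]).

    On the other hand, P_k = p(n-k) p(n) p(k), where p(m) = a_1 ... a_m
    ([lag_prodE]). This formula has two consequences.
    - P_k = P_(n-k). At k = 2 this compares (-1)^((n-2)/2) with -1, so that
      4 divides n ([barker_dvd4]).
    - P_k P_(k+1) = a_(k+1) a_(n-k), as all other factors occur twice
      ([lag_prodM]).
    For odd k, the values of P_(k-1), P_k and P_(k+1) therefore give both
    a_k a_(n+1-k) = - C_k and a_(k+1) a_(n-k) = C_k. The first is the claimed
    formula, and eliminating C_k from the two gives the weak symmetry. *)

Definition lag_prod (x : nat -> int) (n k : nat) : int :=
  \prod_(1 <= j < (n - k).+1) (x j * x (j + k)%N).

Definition prefix_prod (x : nat -> int) (m : nat) : int :=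
  \prod_(1 <= j < m.+1) x j.

Lemma sqr_sign (y : int) : y = -1 \/ y = 1 -> y * y = 1.
Proof. by case=> ->. Qed.

(** The witness t is the number of entries equal to -1. Sum and product are both
    functions of t, which is how the value of a C_k fixes a product. *)
Lemma sum_prod_signs (r : seq nat) (F : nat -> int) :
    {in r, forall i, F i = -1 \/ F i = 1} ->
  exists t : nat, \sum_(i <- r) F i = (size r)%:Z - (t.*2)%:Z /\
                  \prod_(i <- r) F i = (-1) ^+ t.
Proof.
elim: r => [|i r IHr] signF; first by exists 0%N; rewrite !big_nil.
have [|t [sumE prodE]] := IHr.
  by move=> j jr; apply: signF; rewrite inE jr orbT.
rewrite !big_cons sumE prodE /=.
case: (signF i (mem_head i r)) => ->.
- by exists t.+1; rewrite exprS; split=> //; lia.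
- by exists t; rewrite mul1r; split=> //; lia.
Qed.

Lemma prefix_prodS (x : nat -> int) (m : nat) :
  prefix_prod x m.+1 = prefix_prod x m * x m.+1.
Proof. by rewrite /prefix_prod big_nat_recr. Qed.

Lemma prefix_prod_sqr (x : nat -> int) (n m : nat) :
    (forall j, (1 <= j <= n)%N -> x j = -1 \/ x j = 1) -> (m <= n)%N ->
  prefix_prod x m * prefix_prod x m = 1.
Proof.
move=> signx; elim: m => [|m IHm] le_mn; first by rewrite /prefix_prod big_geq.
rewrite prefix_prodS mulrACA IHm ?mul1r; last exact: ltnW.
by apply: sqr_sign; apply: signx.
Qed.

(** The factors a_(j+k) run over a_(k+1), ..., a_n, whose product is
    p(n) / p(k) = p(n) p(k). *)
Lemma lag_prodE (x : nat -> int) (n k : nat) :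
    (forall j, (1 <= j <= n)%N -> x j = -1 \/ x j = 1) -> (k <= n)%N ->
  lag_prod x n k = prefix_prod x (n - k) * prefix_prod x n * prefix_prod x k.
Proof.
move=> signx le_kn; rewrite /lag_prod big_split /= -mulrA; congr (_ * _).
have -> : \prod_(1 <= j < (n - k).+1) x (j + k)%N =
          \prod_(k.+1 <= j < n.+1) x j.
  by rewrite -[k.+1]add1n big_addn subSn.
have -> : prefix_prod x n = prefix_prod x k * \prod_(k.+1 <= j < n.+1) x j.
  by rewrite /prefix_prod (big_cat_nat (n := k.+1)).
by rewrite mulrC mulrA (prefix_prod_sqr signx le_kn) mul1r.
Qed.

Lemma lag_prodM (x : nat -> int) (n k : nat) :
    (forall j, (1 <= j <= n)%N -> x j = -1 \/ x j = 1) -> (k < n)%N ->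
  lag_prod x n k * lag_prod x n k.+1 = x k.+1 * x (n - k)%N.
Proof.
move=> signx lt_kn; rewrite !(lag_prodE signx) //; last exact: ltnW.
have nkE : (n - k = (n - k.+1).+1)%N by lia.
rewrite nkE !prefix_prodS.
have sq1 := prefix_prod_sqr signx (leq_subr k.+1 n).
have sq2 := prefix_prod_sqr signx (leqnn n).
have sq3 := prefix_prod_sqr signx (ltnW lt_kn).
set u := prefix_prod x _ in sq1 *; set v := prefix_prod x n in sq2 *.
set w := prefix_prod x k in sq3 *.
transitivity ((u * u) * (v * v) * (w * w) * (x k.+1 * x (n - k.+1).+1)).
  by ring.
by rewrite sq1 sq2 sq3 !mul1r.
Qed.

Section Barker.

Variables (n : nat) (a : n.-tuple int).
Hypotheses (n_even : ~~ odd n) (a_barker : barker a).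

Local Notation x := (term a).

Let sign_x (j : nat) : (1 <= j <= n)%N -> x j = -1 \/ x j = 1.
Proof. by case: a_barker => a_bin _; apply: a_bin. Qed.

Let lag_count (k : nat) : (1 <= k < n)%N ->
  exists t : nat, [/\ autocorr a k = (n - k)%:Z - (t.*2)%:Z,
    lag_prod x n k = (-1) ^+ t & autocorr a k \in [:: -1; 0; 1]].
Proof.
move=> k_range.
have [|t [sumE prodE]] :=
    @sum_prod_signs (index_iota 1 (n - k).+1) (fun j => x j * x (j + k)%N).
  move=> j; rewrite mem_index_iota => j_range.
  have sign_jk : x (j + k)%N = -1 \/ x (j + k)%N = 1 by apply: sign_x; lia.
  have [|->|->] := @sign_x j; [lia | rewrite mulN1r | by rewrite mul1r].
  by case: sign_jk => ->; [right | left].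
exists t; split=> //; first by rewrite /autocorr sumE size_iota subn1.
by case: a_barker => _; apply; lia.
Qed.

(** Being even, C_k lies in {-1, 0, 1} only as 0, so half of the n - k signs are
    -1. The empty case k = n serves as the successor of the odd lag n - 1. *)
Lemma lag_prod_even (k : nat) : ~~ odd k -> (1 <= k <= n)%N ->
  lag_prod x n k = (-1) ^+ (n - k)./2.
Proof.
move=> k_even k_range; have [->|k_neq] := eqVneq k n.
  by rewrite /lag_prod subnn big_geq.
have [|t [sumE ->]] := @lag_count k; first by lia.
rewrite !inE => Ck; congr (_ ^+ _); lia.
Qed.

(** If C_k = 1, then (n-k-1)/2 of the signs are -1; if C_k = -1, one more. *)
Lemma lag_prod_odd (k : nat) : odd k -> (1 <= k < n)%N ->
  lag_prod x n k = (-1) ^+ (n - k)./2 * autocorr a k.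
Proof.
move=> k_odd k_range; have [t [sumE ->]] := lag_count k_range.
rewrite !inE => Ck.
have [CE|CE] : autocorr a k = 1 \/ autocorr a k = -1 by lia.
- by rewrite CE mulr1; congr (_ ^+ _); lia.
- by rewrite CE -exprSr; congr (_ ^+ _); lia.
Qed.

Lemma barker_dvd4 : (4 <= n)%N -> (4 %| n)%N.
Proof.
move=> n_ge4.
have lag_sym : lag_prod x n 2 = lag_prod x n (n - 2).
  rewrite !(lag_prodE sign_x) ?leq_subr //; try lia.
  rewrite subKn; last by lia.
  by rewrite mulrC mulrA mulrAC.
move: lag_sym; rewrite !lag_prod_even; try lia.
have -> : (n - (n - 2) = 2)%N by lia.
rewrite -signr_odd -[RHS]signr_odd.
by case: (boolP (odd (n - 2)./2)) => //= odd_h _; lia.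
Qed.

Hypothesis n_ge4 : (4 <= n)%N.

(** Lag 0 is not covered by the Barker condition, but P_0 = 1 agrees with the
    formula for even lags because 4 divides n. *)
Lemma lag_prod_pred (k : nat) : odd k -> (1 <= k < n)%N ->
  lag_prod x n k.-1 = - (-1) ^+ (n - k)./2.
Proof.
move=> k_odd k_range; rewrite -mulN1r -exprS.
have -> : (n - k)./2.+1 = (n - k.-1)./2 by lia.
have [k1|k_neq1] := eqVneq k 1%N; last by apply: lag_prod_even; lia.
rewrite k1 (lag_prodE sign_x) // subn0 (prefix_prod_sqr sign_x) //.
rewrite /prefix_prod big_geq // mulr1 -signr_odd.
by have -> : odd n./2 = false by have := barker_dvd4 n_ge4; lia.
Qed.

Lemma barker_autocorr (k : nat) : odd k -> (1 <= k < n)%N ->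
  autocorr a k = - (x k * x (n + 1 - k)%N).
Proof.
move=> k_odd k_range.
have := @lag_prodM x n k.-1 sign_x; rewrite prednK; last by lia.
have -> : (n - k.-1 = n + 1 - k)%N by lia.
move=> <-; last by lia.
rewrite lag_prod_pred // lag_prod_odd // mulNr opprK mulrA.
by rewrite -expr2 sqrr_sign mul1r.
Qed.

Lemma barker_autocorr_succ (k : nat) : odd k -> (1 <= k < n)%N ->
  autocorr a k = x k.+1 * x (n - k)%N.
Proof.
move=> k_odd k_range; rewrite -(lag_prodM sign_x); last by lia.
rewrite lag_prod_odd // lag_prod_even; [|lia|lia].
have -> : (n - k.+1)./2 = (n - k)./2 by lia.
by rewrite mulrAC -expr2 sqrr_sign mul1r.
Qed.

Lemma barker_weak_symmetric : weak_symmetric a.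
Proof.
split; [by case: a_barker | exact: barker_dvd4 |] => j j_odd j_ge1 j_lt.
have j_range : (1 <= j < n)%N by lia.
have eqC := barker_autocorr j_odd j_range.
rewrite (barker_autocorr_succ j_odd j_range) in eqC.
rewrite addn1.
have sq_l : x (n - j)%N * x (n - j)%N = 1 by apply/sqr_sign/sign_x; lia.
have sq_j : x j * x j = 1 by apply/sqr_sign/sign_x; lia.
transitivity (x j * (x j.+1 * x (n - j)%N) * x (n - j)%N).
  by rewrite -!mulrA sq_l mulr1.
rewrite eqC mulrN mulNr; congr (- _).
by rewrite !mulrA sq_j mul1r.
Qed.

End Barker.

Unset Implicit Arguments.

Theorem proposition4 (n : nat) (a : n.-tuple int) (n_even : ~~ odd n)
    (n_ge4 : (4 <= n)%N) (a_barker : barker a) :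
  weak_symmetric a /\
  (forall k : nat, odd k -> (1 <= k < n)%N ->
     autocorr a k = - (term a k * term a (n + 1 - k))).
Proof.
split; first exact: barker_weak_symmetric.
by move=> k; apply: barker_autocorr.
Qed.
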